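(* The speed of the maximum $v_{\max}=v_{\max}(p)$ of the frog model on $\mathbb{Z}$ is an increasing function of the drift parameter $p\in[\frac12,1]$; that is, $v_{\max}(p)\le v_{\max}(q)$ whenever $\frac12\le p\le q\le 1$.
   Context: Frog model on $\mathbb{Z}$ with drift parameter $p\in[\frac12,1]$: $\mathbb{N}=\{1,2,\dots\}$, $\mathbb{N}_0=\mathbb{N}\cup\{0\}$. Let $(X_k^i)_{i\in\mathbb{Z},k\in\mathbb{N}}$ be i.i.d. with $\mathbb{P}(X_1^0=1)=p=1-\mathbb{P}(X_1^0=-1)$, and $S_n^i=\sum_{k=1}^n X_k^i$ for $i\in\mathbb{Z}$, $n\in\mathbb{N}_0$. Initially there is one active frog at $0$ and one sleeping frog at every other site of $\mathbb{Z}$. An active frog moves at each discrete time step according to its own random walk; a sleeping frog does not move, and it becomes active the first time an active frog visits its site, after which it starts its own walk and can wake up other frogs. The frog initially at $i$ is activated at time $T_i\in\mathbb{N}_0\cup\{\infty\}$; formally, with $t(x,y)=\inf\{n\in\mathbb{N}_0: x+S_n^x=y\}$ ($\inf\emptyset=\infty$), $T_i=\inf \sum_{l=1}^{k} t(x_{l-1},x_l)$, the infimum being over all $k\in\mathbb{N}$ and finite sequences $x_0,\dots,x_k\in\mathbb{Z}$ with $x_0=0$, $x_k=i$; in particular $T_0=0$. Its location at time $n$ is $Z_n^i=i$ if $n<T_i$ and $Z_n^i=i+S^i_{n-T_i}$ if $n\ge T_i$. The set of active frogs at time $n$ is $A_n=\{i\in\mathbb{Z}:T_i\le n\}$, and $M_n=\max_{i\in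 A_n}Z_n^i$. It is known that for each $p$ there is a positive constant $v_{\max}=v_{\max}(p)$, called the speed of the maximum, with $v_{\max}=\lim_{n\to\infty}\frac{M_n}{n}$ almost surely. *)

(* Defs.v *)
From HB Require Import structures.
From mathcomp Require Import all_boot all_order all_algebra.
From mathcomp Require Import all_classical all_reals all_analysis.

Set Implicit Arguments.
Unset Strict Implicit.
Unset Printing Implicit Defensive.
Import Order.TTheory GRing.Theory Num.Theory.
Import numFieldNormedType.Exports.
Local Open Scope classical_set_scope.
Local Open Scope ring_scope.

HB.instance Definition _ := isPointed.Build int 0.

(* int carries the discrete sigma-algebra, as nat does in the library *)
HB.instance Definition _ := @isMeasurable.Build default_measure_display
  int discrete_measurable discrete_measurable0
  discrete_measurableC discrete_measurableU.

Section random_walks.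
Context d (T : measurableType d) (R : realType) (P : probability T R).

Definition mutually_independent d' (T' : measurableType d') (I : eqType)
    (X : I -> {RV P >-> T'}) : Prop :=
  forall (s : seq I) (A : I -> set T'), uniq s ->
    (forall i, measurable (A i)) ->
    P (\bigcap_(i in [set` s]) (X i @^-1` A i)) =
    (\prod_(i <- s) P (X i @^-1` A i))%E.

Definition identically_distributed d' (T' : measurableType d') (I : Type)
    (X : I -> {RV P >-> T'}) : Prop :=
  forall (i j : I) (A : set T'), measurable A ->
    distribution P (X i) A = distribution P (X j) A.

(* X i k is the (k+1)-st step of the frog initially at i: steps are numbered
   from 0 here and from 1 in the usual notation X_k^i. *)
Definition frog_steps (p : R) (X : int -> nat -> {RV P >-> int}) : Prop :=
  [/\ mutually_independent (fun ik : int * nat => X ik.1 ik.2),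
      identically_distributed (fun ik : int * nat => X ik.1 ik.2),
      P [set w | X 0 0%N w = 1] = p%:E &
      P [set w | X 0 0%N w = -1] = (1 - p)%:E].

End random_walks.

(* The frog model for one realisation x of all the steps. *)
Section frog_model.
Variables (R : realType) (x : int -> nat -> int).

Definition walk (i : int) (n : nat) : int := \sum_(k < n) x i k.

Definition hitting_time (y z : int) : \bar R :=
  ereal_inf [set n%:R%:E | n in [set n : nat | y + walk y n = z]].

Definition activation_time (i : int) : \bar R :=
  ereal_inf [set t | exists (k : nat) (y : nat -> int),
    [/\ (0 < k)%N, y 0%N = 0, y k = i &
        t = (\sum_(l < k) hitting_time (y l) (y l.+1))%E]].

(* activation_time i is a natural number or +oo, so that in the second branch
   truncn and fine only change its type. *)
Definition location (i : int) (n : nat) : int :=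
  if (n%:R%:E < activation_time i)%E then i
  else i + walk i (n - Num.truncn (fine (activation_time i))).

Definition active (n : nat) : set int :=
  [set i | (activation_time i <= n%:R%:E)%E].

(* The greatest element of the finite nonempty set of locations of the frogs
   active at time n; the default value 0 of xget is never used. *)
Definition frog_max (n : nat) : int :=
  let locations := [set location i n | i in active n] in
  xget 0 (locations `&` ubound locations).

End frog_model.

Definition is_speed_of_max d (T : measurableType d) (R : realType)
    (P : probability T R) (X : int -> nat -> {RV P >-> int}) (v : R) : Prop :=
  {ae P, forall w,
    (frog_max R (fun i k => X i k w) n)%:~R / n%:R @[n --> \oo] --> v}.

(* Main.v *)
Require Import Defs.
From mathcomp Require Import all_boot all_order all_algebra.
From mathcomp Require Import all_classical all_reals all_analysis.
From mathcomp Require Import zify ring lra.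
Import Order.TTheory GRing.Theory Num.Theory.
Import numFieldNormedType.Exports.
Local Open Scope classical_set_scope.
Local Open Scope ring_scope.

(** Coupling the steps of two systems with drifts [p <= q] does not compare
    their maxima: with drift [q] the frogs to the left of the origin wake up
    later, and some of them may be missing from the race. The comparison does
    hold for systems whose frogs all live on the nonnegative half-line and in
    which those of [0 .. m] are awake at time [0] ([reached_mono]): up to the
    front every frog is awake, so larger steps can only move the front faster.

    The frogs on the left are removed by starting far away from the origin. Let
    a single frog be awake at the site [m]. Within time [t <= m] no frog to the
    left of the origin is reached, so whatever this system reaches is reached
    within the same time by the half-line system in which [0 .. m] is awake
    ([prob_reach_segment]). By monotonicity the latter is at least as fast with
    drift [q] as with drift [p] ([prob_reach_mono]). Finally, the whole system
    with drift [q], from the time when it reaches [m], is at least as fast as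
    this half-line system with drift [q] ([reached_concat]).

    Suppose now that [v_max q < v_max p], and let all lengths be proportional
    to [r]. With drift [p], a system started from one frog at [A r] advances by
    [a r] within time [b r] with probability tending to [1], for any
    [a / b < v_max p]. With drift [q], the site [A r] is reached by time [B r]
    with probability tending to [1], for any [A / B < v_max q]. By the
    comparison, with probability bounded below, the drift [q] system reaches
    [(A + a) r] by time [(B + b) r]. The naturals can be chosen with
    [b <= A] and [(A + a) / (B + b) > v_max q] ([speed_gap]), which contradicts
    the definition of [v_max q].

    The two systems live on unrelated probability spaces. All the events that
    are compared depend on finitely many steps, so their probabilities are given
    by the explicit function [coin_prob] of the drift ([prob_local_event]). For
    an upward closed event this function is nondecreasing in the drift
    ([coin_prob_le]), which takes the place of a coupling on a common space. *)

Set Implicit Arguments.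
Unset Strict Implicit.
Unset Printing Implicit Defensive.

(** * Sites reached by the frogs of one realisation *)

(** [S] is the set of sites whose frogs are awake at time [0], and [D] the set
    of sites that carry a frog. The frog model has [S = [set 0]] and
    [D = setT]; the comparison of two drifts goes through a system with another
    [S] and another [D]. The time [t] is an upper bound, not an exact time. *)
Inductive reached (x : int -> nat -> int) (S D : set int) : int -> nat -> Prop :=
| reached_start i t : S i -> reached x S D i t
| reached_move i n t u : reached x S D i t -> D i -> (t + n <= u)%N ->
    reached x S D (i + walk x i n) u.

(** Steps of size at most [1] give a discrete intermediate value theorem and
    make the front move by at most one site per unit of time. *)
Definition short_steps (x : int -> nat -> int) : Prop :=
  forall i k, `|x i k| <= 1.

Definition half_line : set int := [set i | 0 <= i].
Definition segment (m : nat) : set int := [set i | 0 <= i <= m%:Z].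

Lemma walkS x i n : walk x i n.+1 = walk x i n + x i n.
Proof. by rewrite /walk big_ord_recr. Qed.

Lemma walk0 x i : walk x i 0 = 0.
Proof. by rewrite /walk big_ord0. Qed.

Lemma walk_norm x i n : short_steps x -> `|walk x i n| <= n%:Z.
Proof.
move=> sx; elim: n => [|n IH]; first by rewrite walk0.
by rewrite walkS; have := sx i n; lia.
Qed.

Lemma walk_ivt x i n j : short_steps x -> 0 <= j -> j <= walk x i n ->
  exists2 k, (k <= n)%N & walk x i k = j.
Proof.
move=> sx j0; elim: n => [|n IH] jn.
  by exists 0%N => //; move: jn; rewrite walk0; lia.
have [/IH [k kn <-]|jn'] := leP j (walk x i n); first by exists k => //; lia.
exists n.+1 => //; move: jn; rewrite walkS; have := sx i n; lia.
Qed.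

Lemma walk_le x y i n : (forall k, x i k <= y i k) -> walk x i n <= walk y i n.
Proof. by move=> xy; apply: ler_sum => k _. Qed.

Lemma reached_later x S D z t u :
  (t <= u)%N -> reached x S D z t -> reached x S D z u.
Proof.
move=> tu r; case: r tu => [i t' Si _|i n t' u' r Di tn tu].
  exact: reached_start.
by apply: reached_move r Di _; exact: leq_trans tn tu.
Qed.

Lemma reached_dist x S D c M z t : short_steps x ->
    (forall i, S i -> `|i - c| <= M) ->
  reached x S D z t -> `|z - c| <= M + t%:Z.
Proof.
move=> sx SM; elim=> {z t} [i t /SM|i n t u _ IH _ tn]; first lia.
have := walk_norm i n sx; lia.
Qed.

(** The first frog to land on or beyond [w] either crosses [w] or starts from a
    reached site beyond [w]. *)
Lemma reached_below x z t w : short_steps x -> reached x [set 0] setT z t ->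
  0 <= w <= z -> reached x [set 0] setT w t.
Proof.
move=> sx r; elim: r w => {z t} [i t -> w w0|i n t u r IH _ tn w /andP[w0 wz]].
  by apply: reached_start => /=; lia.
have [wi|iw] := leP w i.
  by apply: (@reached_later _ _ _ _ t); [lia|apply: IH; rewrite w0].
have [||k kn kE] := @walk_ivt x i n (w - i) sx; [lia|lia|].
have -> : w = i + walk x i k by rewrite kE; lia.
by apply: reached_move r _ _ => //; lia.
Qed.

(** This is the coupling, and it works because no frog lives to the left of the
    initially awake segment. Larger steps may delay the visits to the left of a
    frog, but every site between [0] and the front has already been reached:
    the statement is strengthened to all sites [w] between [0] and [z]. The
    frog that carries the front of [x] from [i] past [w] is then awake early
    enough for [y] too, and its larger steps make it cross [w] no later. With
    frogs on both half-lines this fails, as the frogs on the left are woken up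
    later when the steps are larger. *)
Lemma reached_mono x y m z t : short_steps y -> (forall i k, x i k <= y i k) ->
  reached x (segment m) half_line z t ->
  0 <= z -> reached y (segment m) half_line z t.
Proof.
move=> sy xy r z0.
suff : forall w, 0 <= w <= z -> reached y (segment m) half_line w t.
  by apply; rewrite z0 lexx.
move: r {z0}; elim=> {z t} [i t Si w wi|i n t u r IH Di tn w /andP[w0 wz]].
  by apply: reached_start; rewrite /segment /= in Si *; lia.
have [wi|iw] := leP w i.
  by apply: (@reached_later _ _ _ _ t); [lia|apply: IH; rewrite w0].
have xyn := @walk_le x y i n (xy i).
have [||k kn kE] := @walk_ivt y i n (w - i) sy; [lia|lia|].
have -> : w = i + walk y i k by rewrite kE; lia.
apply: (@reached_move _ _ _ i k t) => //; last lia.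
by apply: IH; rewrite lexx andbT; exact: Di.
Qed.

(** In time [t <= m] nothing that starts from [m] gets to the left of the
    origin. *)
Lemma reached_from_segment x m z t : short_steps x -> (t <= m)%N ->
  reached x [set m%:Z] setT z t -> reached x (segment m) half_line z t.
Proof.
move=> sx + r; elim: r => {z t} [i t -> _|i n t u r IH _ tn um].
  by apply: reached_start; rewrite /segment /=; lia.
apply: (@reached_move _ _ _ i n t) => //; first by apply: IH; lia.
rewrite /half_line /=.
have := @reached_dist _ _ _ m%:Z 0 _ _ sx _ r.
by move=> /(_ (fun j => ltac:(move=> ->; lia))); lia.
Qed.

(** Once site [m] is reached, the frogs of [segment m] are all awake and have
    had a head start on the system where they wake up at time [s]. *)
Lemma reached_concat x m s z t : short_steps x ->
  reached x [set 0] setT m%:Z s -> reached x (segment m) half_line z t ->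
  reached x [set 0] setT z (s + t).
Proof.
move=> sx rm; elim=> {z t} [i t Si|i n t u _ IH _ tn].
  apply: (@reached_later _ _ _ _ s); first lia.
  exact: reached_below rm Si.
by apply: reached_move IH _ _ => //; lia.
Qed.

Lemma reached_shift x m z t :
  reached (fun i k => x (i + m) k) [set 0] setT z t ->
  reached x [set m] setT (z + m) t.
Proof.
elim=> {z t} [i t ->|i n t u _ IH _ tn]; first by apply: reached_start => /=; lia.
have -> : i + walk (fun i k => x (i + m) k) i n + m = (i + m) + walk x (i + m) n.
  by rewrite addrAC.
exact: reached_move IH _ _.
Qed.

Lemma reached_local x y S D M z t : short_steps x ->
    (forall i, S i -> `|i| <= M) ->
    (forall i k, `|i| <= M + t%:Z -> (k < t)%N -> x i k = y i k) ->
  reached x S D z t -> reached y S D z t.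
Proof.
move=> sx SM + r; elim: r => {z t} [i t Si _|i n t u r IH Di tn xy].
  exact: reached_start.
have -> : walk x i n = walk y i n.
  apply: eq_bigr => k _; apply: xy; last by have := ltn_ord k; lia.
  have := @reached_dist _ _ _ 0 M _ _ sx _ r.
  by move=> /(_ (fun j Sj => ltac:(rewrite subr0; exact: SM))); lia.
apply: (reached_move _ Di tn); apply: IH => j k jM kt; apply: xy; lia.
Qed.

(** * Activation times and the maximum in terms of reached sites *)

Lemma nat_set_min (A : set nat) n : A n ->
  exists2 m, A m & forall k, A k -> (m <= k)%N.
Proof.
move=> An; have exA : exists k, `[< A k >] by exists n; apply/asboolP.
case: (ex_minnP exA) => m /asboolP Am mP; exists m => // k Ak.
by apply: mP; apply/asboolP.
Qed.

Lemma int_set_max (A : set int) (b : int) a : A a -> ubound A b ->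
  exists2 m, A m & ubound A m.
Proof.
move=> Aa bA.
have [|m Am mP] := @nat_set_min [set n : nat | A (b - n%:Z)] (absz (b - a)).
  rewrite /=; have := bA _ Aa; have -> : b - `|b - a|%N%:Z = a; last by [].
  by have := bA _ Aa; lia.
exists (b - m%:Z) => // c Ac.
have := bA _ Ac => cb; have := mP (absz (b - c)).
rewrite /= (_ : b - _ = c); [|lia] => /(_ Ac); lia.
Qed.

Section activation.
Variables (R : realType) (x : int -> nat -> int).
Local Notation awake := (reached x [set 0] setT).

Lemma hitting_time_le y n : (hitting_time R x y (y + walk x y n) <= n%:R%:E)%E.
Proof. by apply: ereal_inf_lbound; exists n. Qed.

Lemma hitting_time_cases y z : hitting_time R x y z = +oo%E \/
  exists2 n, y + walk x y n = z & hitting_time R x y z = n%:R%:E.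
Proof.
have [[n yn]|no] := pselect (exists n, y + walk x y n = z).
  right; have [m ym mP] := @nat_set_min [set n | y + walk x y n = z] n yn.
  exists m => //; apply/eqP; rewrite eq_le -{1}ym hitting_time_le /= leNgt.
  apply/negP => /ereal_inf_lt[_ [k /= yk <-]].
  by rewrite lte_fin ltr_nat ltnNge mP.
left; rewrite /hitting_time -[X in ereal_inf X]/(image _ _).
rewrite (_ : [set n | _] = set0) ?image_set0 ?ereal_inf0 //.
by apply/seteqP; split=> // n yn; apply: no; exists n.
Qed.

Lemma chain_awake (k : nat) (y : nat -> int) : y 0%N = 0 ->
  let s := (\sum_(l < k) hitting_time R x (y l) (y l.+1))%E in
  s = +oo%E \/ exists2 n, s = n%:R%:E & awake (y k) n.
Proof.
move=> y0 /=; elim: k => [|k IH].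
  by right; exists 0%N; [rewrite big_ord0|apply: reached_start].
rewrite big_ord_recr /=.
case: IH => [->|[n -> yn]]; case: (hitting_time_cases (y k) (y k.+1)) => [->|[m ym ->]];
  try by left.
right; exists (n + m)%N; first by rewrite natrD.
by rewrite -ym; apply: reached_move yn _ _.
Qed.

Lemma awake_chain i t : awake i t -> exists (k : nat) (y : nat -> int),
  [/\ (0 < k)%N, y 0%N = 0, y k = i &
      (\sum_(l < k) hitting_time R x (y l) (y l.+1) <= t%:R%:E)%E].
Proof.
elim=> {i t} [i t ->|i n t u _ [k [y [k0 y0 yk yt]]] _ tn].
  exists 1%N, (fun=> 0); split => //; rewrite big_ord1.
  have := hitting_time_le 0 0; rewrite walk0 addr0 => /le_trans; apply.
  by rewrite lee_fin ler_nat.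
exists k.+1, (fun l => if (l <= k)%N then y l else i + walk x i n).
split => //=; first by rewrite ltnn.
rewrite big_ord_recr /= leqnn ltnn yk.
rewrite (eq_bigr (fun l : 'I_k => hitting_time R x (y l) (y l.+1))); last first.
  by move=> l _; rewrite ltn_ord ltnW.
apply: (@le_trans _ _ (t%:R%:E + n%:R%:E)%E).
  by apply: leeD => //; exact: hitting_time_le.
by rewrite -EFinD -natrD lee_fin ler_nat.
Qed.

(** Together with [active_awake] this identifies the infimum over chains with
    the least time at which the site is reached from the origin. *)
Lemma activation_timeE i t : awake i t -> (forall u, awake i u -> (t <= u)%N) ->
  activation_time R x i = t%:R%:E.
Proof.
move=> it tmin; apply/eqP; rewrite eq_le; apply/andP; split.
  have [k [y [k0 y0 yk yt]]] := awake_chain it.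
  by apply: le_trans yt; apply: ereal_inf_lbound; exists k, y.
rewrite leNgt; apply/negP => /ereal_inf_lt[_ [k [y [k0 y0 yk ->]]]].
case: (chain_awake k y0) => [->|[n -> yn]]; first by rewrite ltNge leey.
by rewrite lte_fin ltr_nat ltnNge tmin // -yk.
Qed.

Lemma active_awake i t : active R x t i -> exists u,
  [/\ (u <= t)%N, activation_time R x i = u%:R%:E & awake i u].
Proof.
rewrite /active /= => it.
have /ereal_inf_lt[_ [k [y [k0 y0 yk ->]]]] :
    (activation_time R x i < t.+1%:R%:E)%E.
  by apply: le_lt_trans it _; rewrite lte_fin ltr_nat.
case: (chain_awake k y0) => [->|[n -> yn]]; first by rewrite ltNge leey.
rewrite lte_fin ltr_nat => nt.
have := yn; rewrite yk => /(@nat_set_min (fun u => awake i u))[u iu umin].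
exists u; split => //; last exact: activation_timeE.
by rewrite -ltnS; apply: leq_ltn_trans nt; apply: umin; rewrite -yk.
Qed.

Lemma locationE i n u : activation_time R x i = u%:R%:E -> (u <= n)%N ->
  location R x i n = i + walk x i (n - u).
Proof.
move=> iu un; rewrite /location iu /= natrK lte_fin ltr_nat.
by rewrite ltnNge un.
Qed.

Lemma location_awake i n : active R x n i -> awake (location R x i n) n.
Proof.
move=> /active_awake[u [un iu ru]]; rewrite (locationE iu un).
by apply: reached_move ru _ _ => //; rewrite subnKC.
Qed.

Hypothesis sx : short_steps x.

(** A frog at or beyond [z] at time [n] has been preceded by a visit to [z].
    Since [z] is positive, the maximum is not the default value. *)
Lemma awake_of_frog_max n (z : nat) : (0 < z)%N -> z%:Z <= frog_max R x n ->
  awake z%:Z n.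
Proof.
move=> z0; rewrite /frog_max; case: xgetP => [_ -> [[i iA <-] _]|]; last by lia.
move=> zi; apply: reached_below (location_awake iA) _ => //; lia.
Qed.

(** The time [u] is the activation time of [z]: the frog of [z] then sits at
    [z], whereas at time [t] it may have moved away to the left. *)
Lemma frog_max_of_awake z t : awake z t ->
  exists2 u, (u <= t)%N & awake z u /\ z <= frog_max R x u.
Proof.
move=> /[dup] zt /(@nat_set_min (fun u => awake z u))[u zu umin].
have zE := activation_timeE zu umin.
exists u; [exact: umin|split=> //].
have zA : active R x u z by rewrite /active /= zE.
have zL : location R x z u = z by rewrite (locationE zE) // subnn walk0 addr0.
rewrite /frog_max; set L := [set _ | _ in _].
have [||m Lm mub] := @int_set_max L u%:Z z.
- by exists z.
- move=> _ [i iA <-]; have := @reached_dist x _ _ 0 0 _ _ sx _ (location_awake iA).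
  by move=> /(_ (fun i => ltac:(move=> ->; lia))); lia.
have [_ ub] := @xgetPex _ 0 (L `&` ubound L) (ex_intro _ m (conj Lm mub)).
by apply: ub; exists z.
Qed.

End activation.

(** * Events that depend on finitely many steps *)

Definition coins := int * nat -> bool.

Definition step (b : bool) : int := if b then 1 else -1.

Definition coin_steps (c : coins) (i : int) (k : nat) : int := step (c (i, k)).

Lemma coin_steps_short c : short_steps (coin_steps c).
Proof. by move=> i k; rewrite /coin_steps /step; case: ifP. Qed.

Definition set_coin (c : coins) a b : coins := fun a' => if a' == a then b else c a'.

Definition local_event (s : seq (int * nat)) (E : set coins) : Prop :=
  forall c c', {in s, c =1 c'} -> E c -> E c'.

Definition upward_closed (E : set coins) : Prop :=
  forall c c' : coins, (forall a, c a -> c' a) -> E c -> E c'.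

(** Probability of [E] when the coins in [s] are tossed with success probability
    [p] and the others are fixed to [c]. As a number that depends on [p] alone
    it can be compared between unrelated probability spaces. *)
Fixpoint coin_prob (R : realType) (p : R) s (E : set coins) (c : coins) : R :=
  if s is a :: s' then p * coin_prob p s' E (set_coin c a true) +
                       (1 - p) * coin_prob p s' E (set_coin c a false)
  else (`[< E c >])%:R.

Definition coin_weight (R : realType) (p : R) (b : bool) : R := if b then p else 1 - p.

(** One coin at a time: [p * u + (1 - p) * v] with [v <= u] is nondecreasing in
    [p], [u] and [v]. *)
Lemma coin_prob_le (R : realType) (p q : R) s E (c c' : coins) :
  0 <= p -> p <= q -> q <= 1 -> upward_closed E -> (forall a, c a -> c' a) ->
  coin_prob p s E c <= coin_prob q s E c'.
Proof.
move=> p0 pq q1 upE; elim: s p q p0 pq q1 c c' => [|a s IH] p q p0 pq q1 c c' cc' /=.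
  rewrite ler_nat; case: asboolP => // Ec; case: asboolP => // -[].
  exact: upE Ec.
have ccb (b : bool) a' : set_coin c a b a' -> set_coin c' a b a'.
  by rewrite /set_coin; case: ifP => // _; exact: cc'.
have := IH _ _ p0 pq q1 _ _ (ccb true); have := IH _ _ p0 pq q1 _ _ (ccb false).
have /(IH q q (le_trans p0 pq) (lexx q) q1) :
    forall a', set_coin c' a false a' -> set_coin c' a true a'.
  by move=> a'; rewrite /set_coin; case: ifP.
nra.
Qed.

Section law.
Context d (T : measurableType d) (R : realType) (P : probability T R).
Implicit Types (X : int -> nat -> {RV P >-> int}) (p : R).

(** A step is read as a coin that shows whether it equals [1], so that no null
    set has to be removed in the computations. *)
Definition right_steps X (w : T) : coins := fun a => X a.1 a.2 w == 1.

Definition cylinder X (s : seq (int * nat)) (c : coins) : set T :=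
  [set w | {in s, right_steps X w =1 c}].

Definition coin_law p X : Prop := forall s (c : coins), uniq s ->
  measurable (cylinder X s c) /\
  P (cylinder X s c) = (\prod_(a <- s) coin_weight p (c a))%:E.

(** [measureU] with both sides stated as values of [P], which makes them
    available for rewriting with the values of [P] computed before. *)
Lemma probU (A B : set T) : measurable A -> measurable B -> A `&` B = set0 ->
  P (A `|` B) = (P A + P B)%E.
Proof. exact: measureU. Qed.

Lemma coin_law_shift p X m :
  coin_law p X -> coin_law p (fun i k => X (i + m) k).
Proof.
move=> lawX s c us; pose f (a : int * nat) := (a.1 + m, a.2).
have := lawX (map f s) (fun a => c (a.1 - m, a.2)); rewrite map_inj_uniq; last first.
  by move=> [i k] [j l] [/addIr-> ->].
move=> /(_ us); rewrite big_map.
have -> : cylinder X (map f s) (fun a => c (a.1 - m, a.2)) =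
    cylinder (fun i k => X (i + m) k) s c.
  apply/seteqP; split=> w wc /= a; last first.
    by case/mapP => -[i k] /wc wa -> /=; rewrite addrK -wa.
  by case: a => i k /(map_f f) /wc /=; rewrite addrK.
congr (_ /\ _ = _%:E); apply: eq_bigr => -[i k] _ /=; by rewrite addrK.
Qed.

(** The coins in [s1] are already revealed; the induction reveals those of [s2]
    one by one, splitting the event into two disjoint cylinders. *)
Lemma prob_local_event_cylinder p X E s2 s1 c : coin_law p X ->
  uniq (s1 ++ s2) -> local_event (s1 ++ s2) E ->
  measurable (cylinder X s1 c `&` [set w | E (right_steps X w)]) /\
  P (cylinder X s1 c `&` [set w | E (right_steps X w)]) =
  (\prod_(a <- s1) coin_weight p (c a) * coin_prob p s2 E c)%:E.
Proof.
move=> lawX; elim: s2 s1 c => [|a s2 IH] s1 c us locE /=.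
  rewrite cats0 in us locE; have [mC PC] := lawX s1 c us.
  have [Ec|nEc] := asboolP (E c).
    rewrite mulr1 (_ : _ `&` _ = cylinder X s1 c) //.
    apply/seteqP; split=> [w []//|w wc]; split=> //=.
    by apply: locE Ec => a /wc.
  rewrite mulr0 (_ : _ `&` _ = set0) ?measure0; last first.
    by apply/seteqP; split=> // w [wc Ew]; apply: nEc; exact: locE Ew.
  by split; [exact: measurable0|].
have perm : perm_eq (a :: s1 ++ s2) (s1 ++ a :: s2)
  by rewrite perm_sym perm_catC /= perm_cons perm_catC.
have us' : uniq ((a :: s1) ++ s2) by rewrite (perm_uniq perm).
have locE' : local_event ((a :: s1) ++ s2) E.
  by move=> c1 c2 cc; apply: locE => b; rewrite -(perm_mem perm) => /cc.
have [m1 P1] := IH (a :: s1) (set_coin c a true) us' locE'.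
have [m0 P0] := IH (a :: s1) (set_coin c a false) us' locE'.
have as1 : a \notin s1 by move: us'; rewrite /= mem_cat negb_or; case/andP => /andP[].
have cylE b w : cylinder X (a :: s1) (set_coin c a b) w <->
    cylinder X s1 c w /\ right_steps X w a = b.
  split=> [wc|[wc wa] a'].
    split=> [a' a's|]; last first.
      by have := wc a (mem_head _ _); rewrite /set_coin eqxx.
    have := wc a'; rewrite in_cons a's orbT => -> //; rewrite /set_coin.
    by case: eqP a's as1 => // -> ->.
  rewrite in_cons /set_coin; case: eqP => [-> //|_ /=]; exact: wc.
have prodE b : \prod_(a' <- a :: s1) coin_weight p (set_coin c a b a') =
    coin_weight p b * \prod_(a' <- s1) coin_weight p (c a').
  rewrite big_cons {1}/set_coin eqxx; congr (_ * _).
  apply: eq_big_seq => a' a's; rewrite /set_coin.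
  by case: eqP a's as1 => // -> ->.
rewrite (_ : _ `&` _ =
   (cylinder X (a :: s1) (set_coin c a true) `&` [set w | E (right_steps X w)]) `|`
   (cylinder X (a :: s1) (set_coin c a false) `&` [set w | E (right_steps X w)]));
   last first.
  apply/seteqP; split=> [w [wc Ew]|w [[/cylE[wc _] Ew]|[/cylE[wc _] Ew]]] //.
  by case aE : (right_steps X w a); [left|right]; split => //; apply/cylE.
split; first exact: measurableU.
rewrite probU //; last first.
  by apply/seteqP; split=> // w [[/cylE[_ wt] _] [/cylE[_]]]; rewrite wt.
by rewrite P1 P0 !prodE -EFinD /=; congr (_%:E); ring.
Qed.

Lemma prob_local_event p X E s c : coin_law p X -> uniq s -> local_event s E ->
  measurable [set w | E (right_steps X w)] /\
  P [set w | E (right_steps X w)] = (coin_prob p s E c)%:E.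
Proof.
move=> lawX us locE.
have := @prob_local_event_cylinder p X E s [::] c lawX us locE.
rewrite big_nil mul1r (_ : cylinder X [::] c = setT) ?setTI //.
by apply/seteqP; split=> // w _ a.
Qed.

Lemma measurable_preim (X : {RV P >-> int}) (A : set int) : measurable (X @^-1` A).
Proof. by rewrite -[_ @^-1` _]setTI; exact: measurable_funP. Qed.

Lemma frog_steps_right p X i k : frog_steps p X -> P (X i k @^-1` [set 1]) = p%:E.
Proof. by case=> _ /(_ (i, k) (0, 0%N) [set 1]) + <- _; apply. Qed.

Lemma frog_steps_left p X i k : frog_steps p X ->
  P (X i k @^-1` [set -1]) = (1 - p)%:E.
Proof. by case=> _ /(_ (i, k) (0, 0%N) [set -1]) + _ <-; apply. Qed.

Lemma frog_steps_coin_law p X : frog_steps p X -> coin_law p X.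
Proof.
move=> fX s c us; case: (fX) => indX _ _ _.
pose A a : set int := if c a then [set 1] else ~` [set 1].
have -> : cylinder X s c = \bigcap_(a in [set` s]) (X a.1 a.2 @^-1` A a).
  apply/seteqP; split=> w wc a /= /wc; rewrite /right_steps /A /preimage.
    by move=> <-; case: eqP.
  by case: (c a) => /= /eqP; [|move/negbTE].
split.
  rewrite bigcap_seq; apply: bigsetI_measurable => a _; exact: measurable_preim.
rewrite (indX s A us) // -prodEFin; apply: eq_bigr => a _.
rewrite /A /coin_weight; case: (c a); first exact: frog_steps_right.
rewrite -preimage_setC probability_setC ?(frog_steps_right _ _ fX) //.
exact: measurable_preim.
Qed.

Lemma frog_steps_ae p X : frog_steps p X ->
  {ae P, forall w, (fun i k => X i k w) = coin_steps (right_steps X w)}.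
Proof.
move=> fX.
have aeX i k : {ae P, forall w, X i k w = step (right_steps X w (i, k))}.
  pose B := X i k @^-1` [set 1] `|` X i k @^-1` [set -1].
  have mB : measurable B by apply: measurableU; exact: measurable_preim.
  have PB : P B = 1%E.
    rewrite probU; [|exact: measurable_preim|exact: measurable_preim|].
      rewrite (frog_steps_right _ _ fX) (frog_steps_left _ _ fX).
      by rewrite -EFinD addrC subrK.
    by apply/seteqP; split=> // w [/= ->].
  exists (~` B); split; first exact: measurableC.
    by rewrite probability_setC // PB subee.
  move=> w /= nw wB; apply: nw; rewrite /right_steps /=.
  by case: wB => /= ->.
have : {ae P, forall w, forall n : nat,
    if unpickle n is Some a then X a.1 a.2 w = step (right_steps X w a) else True}.
  apply: ae_foralln => n; case: (unpickle n) => [[i k]|]; first exact: aeX.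
  exact: nearW.
apply: filterS => w wn; apply/funext => i; apply/funext => k.
by have := wn (pickle (i, k)); rewrite pickleK.
Qed.

(** Continuity from below along the increasing events that [E] holds from time
    [N] on, whose union has probability [1]. *)
Lemma ae_eventually_prob (E : nat -> set T) : (forall n, measurable (E n)) ->
  {ae P, forall w, \forall n \near \oo, E n w} ->
  \forall n \near \oo, (2^-1%:E < P (E n))%E.
Proof.
move=> mE aeE; pose F N := \bigcap_(n in [set n | (N <= n)%N]) E n.
have mF N : measurable (F N) by apply: bigcap_measurable => //; exists N => /=.
have mUF : measurable (\bigcup_N F N) by exact: bigcupT_measurable.
have PF : P (\bigcup_N F N) = 1%E.
  have F0 : P (~` \bigcup_N F N) = 0%E.
    apply: measure_negligible; first exact: measurableC.
    apply: negligibleS aeE => w wF [N _ NE]; apply: wF; exists N => // n /NE; exact.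
  have := probability_setC P mUF; rewrite F0 => /esym/eqP.
  by rewrite sube_eq // ?add0e => /eqP.
have Fmono : {homo F : n m / (n <= m)%N >-> (n <= m)%O}.
  move=> n m nm; apply/subsetPset => w wF k /= mk; apply: wF; exact: leq_trans mk.
have : nbhs (P (\bigcup_N F N)) [set y | (2^-1%:E < y)%E].
  rewrite PF; apply: open_nbhs_nbhs; split; first exact: open_ereal_gt_ereal.
  by rewrite /= lte_fin invf_lt1 // ltr1n.
move=> /(nondecreasing_cvg_mu mF mUF Fmono)[N _ NF]; exists N => // n Nn.
apply: (lt_le_trans (NF n Nn)).
by apply: le_measure; rewrite ?inE //; apply: bigcap_inf => /=.
Qed.

End law.

(** * Comparison of the probabilities of reaching a site *)

Definition box (M t : nat) : seq (int * nat) :=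
  undup [seq (j%:Z - M%:Z, k) | j <- iota 0 (2 * M).+1, k <- iota 0 t].

Lemma mem_box M t i k : `|i| <= M%:Z -> (k < t)%N -> (i, k) \in box M t.
Proof.
move=> iM kt; rewrite mem_undup; apply/allpairsP.
exists (absz (i + M%:Z), k); split; [rewrite mem_iota|rewrite mem_iota|].
- by move: iM => /=; lia.
- by move=> /=; lia.
- by congr (_, _); move: iM => /=; lia.
Qed.

Definition reach_event (S D : set int) z t : set coins :=
  [set c | reached (coin_steps c) S D z t].

(** A frog that wakes up by time [t] lives at distance at most [t] from one of
    the frogs that are awake at the start. *)
Lemma reach_event_local (S D : set int) (M : nat) z t : (forall i, S i -> `|i| <= M%:Z) ->
  local_event (box (M + t) t) (reach_event S D z t).
Proof.
move=> SM c c' cc; apply: reached_local (coin_steps_short c) SM _ => i k iM kt.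
by rewrite /coin_steps cc // mem_box.
Qed.

Lemma segment_norm m i : segment m i -> `|i| <= m%:Z.
Proof. by rewrite /segment /= => /andP[i0 im]; rewrite ger0_norm. Qed.

Lemma origin_norm (i : int) : [set 0] i -> `|i| <= 0%N%:Z.
Proof. by move=> ->; rewrite normr0. Qed.

Lemma reach_event_up m z t : 0 <= z ->
  upward_closed (reach_event (segment m) half_line z t).
Proof.
move=> z0 c c' cc /= cz; apply: reached_mono cz _ => //; first exact: coin_steps_short.
move=> i k; rewrite /coin_steps /step; have := cc (i, k).
by case: (c _) => [->//|_]; case: (c' _).
Qed.

Section coupling.
Context d (T : measurableType d) (R : realType) (P : probability T R).

Lemma measurable_reach (p : R) (X : int -> nat -> {RV P >-> int}) (S D : set int) (M : nat) z t :
  coin_law p X -> (forall i, S i -> `|i| <= M%:Z) ->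
  measurable [set w | reach_event S D z t (right_steps X w)].
Proof.
move=> lawX SM.
by case: (prob_local_event (fun=> true) lawX (undup_uniq _) (@reach_event_local S D M z t SM)).
Qed.

(** Translate by [m], then discard the frogs on the negative half-line, which
    are too far to help before time [t], and wake up those of [segment m]. *)
Lemma prob_reach_segment (p : R) (X : int -> nat -> {RV P >-> int}) m (z t : nat) :
  coin_law p X -> (t <= m)%N ->
  (P [set w | reach_event [set 0%R] setT z%:Z t (right_steps X w)] <=
   P [set w | reach_event (segment m) half_line (z + m)%N%:Z t (right_steps X w)])%E.
Proof.
move=> lawX tm; have law' := coin_law_shift m%:Z lawX.
have loc := @reach_event_local _ setT _ z%:Z t origin_norm.
have [_ ->] := prob_local_event (fun=> true) lawX (undup_uniq _) loc.
have [mE <-] := prob_local_event (fun=> true) law' (undup_uniq _) loc.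
apply: le_measure; rewrite ?inE //.
  exact: (measurable_reach _ _ _ lawX (@segment_norm m)).
move=> w wz; apply: reached_from_segment => //; first exact: coin_steps_short.
by rewrite PoszD; exact: reached_shift wz.
Qed.

End coupling.

Lemma prob_reach_mono d (T : measurableType d) d' (T' : measurableType d')
    (R : realType) (P : probability T R) (Q : probability T' R) (p q : R)
    (X : int -> nat -> {RV P >-> int}) (Y : int -> nat -> {RV Q >-> int}) m z t :
  coin_law p X -> coin_law q Y -> 0 <= p -> p <= q -> q <= 1 -> 0 <= z ->
  (P [set w | reach_event (segment m) half_line z t (right_steps X w)] <=
   Q [set w | reach_event (segment m) half_line z t (right_steps Y w)])%E.
Proof.
move=> lawX lawY p0 pq q1 z0.
have loc := @reach_event_local _ half_line _ z t (@segment_norm m).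
have [_ ->] := prob_local_event (fun=> true) lawX (undup_uniq _) loc.
have [_ ->] := prob_local_event (fun=> true) lawY (undup_uniq _) loc.
by rewrite lee_fin; apply: coin_prob_le => //; exact: reach_event_up.
Qed.

(** * Asymptotics of the maximum *)

Section linear_growth.
Variables (R : realType) (u : nat -> int) (v : R).
Hypothesis uv : (u n)%:~R / n%:R @[n --> \oo] --> v.

Lemma near_mulnl (Q : nat -> Prop) (b : nat) : (0 < b)%N ->
  (\forall n \near \oo, Q n) -> \forall r \near \oo, Q (b * r)%N.
Proof. by move=> b0 [N _ NQ]; exists N => // r /= Nr; apply: NQ => /=; nia. Qed.

Lemma growth_lower (a b : nat) : (0 < b)%N -> a%:R < v * b%:R ->
  \forall r \near \oo, (a * r)%N%:Z <= u (b * r)%N.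
Proof.
move=> b0 ab; have bR : 0 < b%:R :> R by rewrite ltr0n.
have lt_v : a%:R / b%:R < v by rewrite ltr_pdivrMr.
have uE : \forall n \near \oo, (a%:R / b%:R : R) < (u n)%:~R / n%:R.
  exact: (cvgr_gt v uv).
near=> r; have r0 : (0 < r)%N by near: r; exact: nbhs_infty_gt.
have : (a%:R / b%:R : R) < (u (b * r)%N)%:~R / (b * r)%N%:R.
  near: r; exact: near_mulnl uE.
have rR : 0 < r%:R :> R by rewrite ltr0n.
rewrite ltr_pdivlMr ?ltr0n ?muln_gt0 ?b0 // natrM mulrA divfK ?gt_eqF //.
by rewrite -natrM -[X in X < _ -> _]/((a * r)%N%:Z%:~R) ltr_int => /ltW.
Unshelve. all: by end_near. Qed.

(** The bound is uniform over the times [k] in a range, because the time at which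
    the maximum passes a given site is only known to lie in that range. *)
Lemma growth_upper (a b : nat) : (0 < a)%N -> v * b%:R < a%:R ->
  \forall r \near \oo, forall k, (a * r <= k <= b * r)%N -> u k < (a * r)%N%:Z.
Proof.
move=> a0 ab; have [b0|b0] := posnP b.
  by exists 1%N => // r /= r0 k; rewrite b0 mul0n leqn0 => /andP[+ /eqP k0]; nia.
have bR : 0 < b%:R :> R by rewrite ltr0n.
have lt_v : v < a%:R / b%:R by rewrite ltr_pdivlMr.
have uE : \forall n \near \oo, (u n)%:~R / n%:R < (a%:R / b%:R : R).
  exact: (cvgr_lt v uv).
case: uE => N _ NE; exists N.+1 => // r /= Nr k /andP[ark kbr].
have Nk : (N <= k)%N by nia.
have k0 : (0 < k)%N by nia.
have := NE k Nk; rewrite ltr_pdivrMr ?ltr0n // => /= uk.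
have : (u k)%:~R < (a * r)%N%:R :> R.
  apply: (lt_le_trans uk); rewrite mulrAC ler_pdivrMr // -!natrM ler_nat.
  by rewrite -mulnA leq_mul2l [(r * b)%N]mulnC kbr orbT.
by rewrite -[X in _ < X -> _]/((a * r)%N%:Z%:~R) ltr_int.
Qed.

End linear_growth.

(** Here [A] falls short of [v B] by at most [3/2], while [a] exceeds [v b] by
    more than that. The bound [b <= A] gives the room needed to neglect the
    frogs on the negative half-line. *)
Lemma speed_gap (R : realType) (v v' : R) : 0 < v -> v < v' ->
  exists A B a b : nat, [/\ [/\ (0 < a)%N, (0 < b)%N, (0 < B)%N & (b <= A)%N],
    A%:R < v * B%:R, a%:R < v' * b%:R & v * (B + b)%N%:R < (A + a)%N%:R].
Proof.
move=> v0 vv'; have g0 : 0 < v' - v by rewrite subr_gt0.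
(* A natural number [a] with [v b + 2 < a < v' b] must exist. *)
pose b := (Num.trunc (4 / (v' - v))).+1.
have bP : 4 < (v' - v) * b%:R.
  rewrite mulrC -ltr_pdivrMr //.
  by have /andP[] := truncn_itv (ltW (divr_gt0 (ltr0n R 4) g0)).
have vb0 : 0 <= v * b%:R by rewrite mulr_ge0 // ltW.
have /andP[a1 a2] := truncn_itv vb0.
pose B := (Num.trunc (b.+2%:R / v)).+1.
have BP : b.+2%:R < v * B%:R.
  rewrite mulrC -ltr_pdivrMr //.
  by have /andP[] := truncn_itv (ltW (divr_gt0 (ltr0Sn R b.+1) v0)).
have b0 : 0 <= b%:R :> R by [].
have vB0 : 0 <= v * B%:R - 2^-1.
  by move: BP; rewrite -addn2 natrD; lra.
have /andP[A1 A2] := truncn_itv vB0.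
exists (Num.trunc (v * B%:R - 2^-1)), B, (Num.trunc (v * b%:R)).+3, b.
move: (Num.trunc (v * b%:R)) (Num.trunc (v * B%:R - _)) a1 a2 A1 A2 => a A.
rewrite -natr1 => a1 a2 A1; rewrite -(natr1 A) => A2.
rewrite -addn2 natrD in BP; split; [split => //| | |].
- rewrite -ltnS -(ltr_nat R) -natr1. lra.
- by lra.
- move: bP; rewrite -addn3 natrD mulrBl => bP. lra.
- by rewrite -addn3 !natrD; lra.
Qed.

Section fronts.
Context d (T : measurableType d) (R : realType) (P : probability T R).
Variables (p v : R) (X : int -> nat -> {RV P >-> int}).
Hypotheses (fX : frog_steps p X) (vX : is_speed_of_max X v).

Lemma ae_coin_speed : {ae P, forall w,
  (frog_max R (coin_steps (right_steps X w)) n)%:~R / n%:R @[n --> \oo] --> v}.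
Proof. by apply: filterS2 (frog_steps_ae fX) vX => w ->. Qed.

Lemma ae_reach (a b : nat) : (0 < a)%N -> (0 < b)%N -> a%:R < v * b%:R ->
  {ae P, forall w, \forall r \near \oo,
    reach_event [set 0] setT (a * r)%N%:Z (b * r) (right_steps X w)}.
Proof.
move=> a0 b0 ab; apply: filterS ae_coin_speed => w vw.
have ge_ar := growth_lower vw b0 ab.
near=> r; have r0 : (0 < r)%N by near: r; exact: nbhs_infty_gt.
apply: (@awake_of_frog_max R); [exact: coin_steps_short|by rewrite muln_gt0 a0|].
by near: r.
Unshelve. all: by end_near. Qed.

Lemma ae_not_reach (a b : nat) : (0 < a)%N -> v * b%:R < a%:R ->
  {ae P, forall w, \forall r \near \oo,
    ~ reach_event [set 0] setT (a * r)%N%:Z (b * r) (right_steps X w)}.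
Proof.
move=> a0 ab; apply: filterS ae_coin_speed => w vw.
apply: filterS (growth_upper vw a0 ab) => r lt_ar /(@frog_max_of_awake R).
case=> [|u ub [au ge_ar]]; first exact: coin_steps_short.
(* The front moves by at most one site per unit of time. *)
have aru : (a * r <= u)%N.
  have := @reached_dist _ _ _ 0 0 _ _ (coin_steps_short _) _ au.
  by move=> /(_ (fun j => ltac:(move=> ->; lia))); lia.
by have := lt_ar u; rewrite aru ub => /(_ isT); rewrite ltNge ge_ar.
Qed.

(** If the frogs of [segment (A r)] reached [(a + A) r] within time [b r], the
    full system would reach it by time [(B + b) r], faster than its speed
    allows. *)
Lemma ae_not_reach_segment (A B a b : nat) : (0 < A)%N -> (0 < B)%N ->
    A%:R < v * B%:R -> v * (B + b)%N%:R < (A + a)%N%:R ->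
  {ae P, forall w, \forall r \near \oo,
    ~ reach_event (segment (A * r)) half_line (a * r + A * r)%N%:Z (b * r)
        (right_steps X w)}.
Proof.
move=> A0 B0 AB ABab; have Aa0 : (0 < A + a)%N by rewrite addn_gt0 A0.
apply: filterS2 (ae_reach A0 B0 AB) (ae_not_reach Aa0 ABab) => w.
apply: filterS2 => r Ar nAar aAr; apply: nAar.
have := reached_concat (coin_steps_short _) Ar aAr.
by rewrite -mulnDl addnC -mulnDl.
Qed.

End fronts.

Theorem theorem1p2 (R : realType)
    (d : R -> measure_display) (Omega : forall p : R, measurableType (d p))
    (P : forall p : R, probability (Omega p) R)
    (X : forall p : R, int -> nat -> {RV (P p) >-> int})
    (v_max : R -> R)
    (frogs : forall p : R, 2^-1 <= p <= 1 -> frog_steps p (X p))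
    (speed : forall p : R, 2^-1 <= p <= 1 ->
      0 < v_max p /\ is_speed_of_max (X p) (v_max p)) :
  forall p q : R, 2^-1 <= p -> p <= q -> q <= 1 -> v_max p <= v_max q.
Proof.
move=> p q hp pq q1; rewrite leNgt; apply/negP => vqp.
have p01 : 2^-1 <= p <= 1 by rewrite hp (le_trans pq).
have q01 : 2^-1 <= q <= 1 by rewrite q1 (le_trans hp).
have [[_ vp] [vq0 vq]] := (speed _ p01, speed _ q01).
have [fp fq] := (frogs _ p01, frogs _ q01).
have [lawp lawq] := (frog_steps_coin_law fp, frog_steps_coin_law fq).
have [A [B [a [b [[a0 b0 B0 bA] AB ab ABab]]]]] := speed_gap vq0 vqp.
have A0 : (0 < A)%N by exact: leq_trans bA.
have Ep := ae_eventually_prob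
  (fun r => measurable_reach setT (a * r)%N%:Z (b * r) lawp origin_norm)
  (ae_reach fp vp a0 b0 ab).
have mq r := measurable_reach half_line (a * r + A * r)%N%:Z (b * r) lawq
  (@segment_norm (A * r)).
have Eq := ae_eventually_prob (fun r => measurableC (mq r))
  (ae_not_reach_segment fq vq A0 B0 AB ABab).
near \oo => r.
have : (2^-1%:E < P p [set w | reach_event [set 0%R] setT (a * r)%N%:Z (b * r)
    (right_steps (X p) w)])%E by near: r; exact: Ep.
have : (2^-1%:E < P q (~` [set w | reach_event (segment (A * r)) half_line
    (a * r + A * r)%N%:Z (b * r) (right_steps (X q) w)]))%E by near: r; exact: Eq.
rewrite probability_setC; last exact: mq.
have p0 : 0 <= p by apply: le_trans hp; rewrite invr_ge0.
have bAr : (b * r <= A * r)%N by rewrite leq_mul.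
have z0 : 0 <= (a * r + A * r)%N%:Z by [].
have := le_trans (prob_reach_segment (a * r) lawp bAr)
  (prob_reach_mono (A * r) (b * r) lawp lawq p0 pq q1 z0).
rewrite -(fineK (fin_num_measure _ _ (mq r))) => leE ltq /lt_le_trans-/(_ _ leE).
by move: ltq; rewrite -EFinB !lte_fin; lra.
Unshelve. all: by end_near. Qed.
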